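(* Let $(A,\cdot,[-,-,-],\varepsilon)$ be a non-commutative ternary Leibniz-Nambu-Poisson color algebra. Then $A\otimes A$ is endowed with a non-commutative Leibniz-Poisson color algebra structure (with bicharacter $\varepsilon$) for the structure maps defined on homogeneous $x,y,x',y'\in\mathcal{H}(A)$ by $$(x\otimes y)\cdot(x'\otimes y'):=\varepsilon(y,x')(x\cdot x')\otimes(y\cdot y'),$$ $$[x\otimes y,x'\otimes y']:=x\otimes[y,x',y']+\varepsilon(y,x'+y')[x,x',y']\otimes y.$$
   Context: $\mathbb{K}$ is a field of characteristic different from 2 and $G$ is an abelian group. A bicharacter is a map $\varepsilon:G\times G\to\mathbb{K}^*$ with $\varepsilon(a,b)\varepsilon(b,a)=1$, $\varepsilon(a,b+c)=\varepsilon(a,b)\varepsilon(a,c)$, $\varepsilon(a+b,c)=\varepsilon(a,c)\varepsilon(b,c)$. For a $G$-graded vector space $V=\bigoplus_{a\in G}V_a$ over $\mathbb{K}$, $\mathcal{H}(V)$ denotes the set of homogeneous elements. For homogeneous $x,y,z$ one writes $\varepsilon(x,y)$ for $\varepsilon(\deg x,\deg y)$, $\varepsilon(x,y+z)$ for $\varepsilon(\deg x,\deg y+\deg z)$, etc. A multilinear map is even if the degree of its value on homogeneous elements is the sum of their degrees. $A\otimes A$ carries the usual grading, in which $x\otimes y$ has degree $\deg x+\deg y$. A non-commutative ternary Leibniz-Nambu-Poisson color algebra is a quadruple $(A,\cdot,[-,-,-],\varepsilon)$, with $A$ a $G$-graded vector space, $\cdot$ even bilinear, $[-,-,-]$ even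 trilinear and $\varepsilon$ a bicharacter, such that for all $x,y,z,t,u\in\mathcal{H}(A)$: 1) $(x\cdot y)\cdot z=x\cdot(y\cdot z)$; 2) $[[x,y,z],t,u]=[x,y,[z,t,u]]+\varepsilon(z,t+u)[x,[y,t,u],z]+\varepsilon(y+z,t+u)[[x,t,u],y,z]$; 3) $[x\cdot y,z,t]=x\cdot[y,z,t]+\varepsilon(y,z+t)[x,z,t]\cdot y$. A non-commutative Leibniz-Poisson color algebra is a quadruple $(P,\cdot,[-,-],\varepsilon)$, with $P$ a $G$-graded vector space, $\cdot$ and $[-,-]$ even bilinear maps $P\otimes P\to P$ and $\varepsilon$ a bicharacter, such that for all $x,y,z\in\mathcal{H}(P)$: $(x\cdot y)\cdot z=x\cdot(y\cdot z)$; $[[x,y],z]=[x,[y,z]]+\varepsilon(y,z)[[x,z],y]$; $[x\cdot y,z]=x\cdot[y,z]+\varepsilon(y,z)[x,z]\cdot y$. *)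

(* Defs.v *)
From HB Require Import structures.
From mathcomp Require Import all_boot all_algebra.
From mathcomp Require Import boolp freeg.

Set Implicit Arguments.
Unset Strict Implicit.
Unset Printing Implicit Defensive.

Import GRing.Theory.
Local Open Scope ring_scope.
Local Open Scope quotient_scope.

Definition span (K : fieldType) (V : lmodType K) (S : V -> Prop) : {pred V} :=
  fun v => `[< exists2 s : seq (K * V),
    (forall p, p \in s -> S p.2) & v = \sum_(p <- s) p.1 *: p.2 >].

Lemma span_submod_closed (K : fieldType) (V : lmodType K) (S : V -> Prop) :
  submod_closed (span S).
Proof.
split; first by apply/asboolP; exists [::] => //; rewrite big_nil.
move=> k u v /asboolP[s Ss ->] /asboolP[t St ->]; apply/asboolP.
exists ([seq (k * p.1, p.2) | p <- s] ++ t).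
  move=> p; rewrite mem_cat => /orP[/mapP[q qs ->]|/St //].
  exact: (Ss _ qs).
rewrite big_cat big_map /= scaler_sumr; congr (_ + _).
by apply: eq_bigr => p _; rewrite scalerA.
Qed.

(* The library has no tensor product of vector spaces. Here [tensor U V] is   *)
(* the free module on [U * V] modulo the span of the bilinearity relators;    *)
(* its universal property is [tens_bilinear], [tensor_liftE] and              *)
(* [tensor_lift_uniq].                                                        *)
Section Tensor.
Variables (K : fieldType) (U V : lmodType K).

Let free := {freeg (U * V)%type / K}.
Let gen (u : U) (v : V) : free := [freeg [:: (1, (u, v))]].

Variant tensor_relator : free -> Prop :=
| TensorRelatorL k u u' v :
    tensor_relator (gen (k *: u + u') v - (k *: gen u v + gen u' v))
| TensorRelatorR k u v v' :
    tensor_relator (gen u (k *: v + v') - (k *: gen u v + gen u v')).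

Definition tensor_kernel : {pred free} := span tensor_relator.

Fact tensor_kernel_zmod_closed : zmod_closed tensor_kernel.
Proof.
have [k0 kD] := span_submod_closed tensor_relator; split=> // u v ku kv.
by rewrite addrC -scaleN1r; apply: kD.
Qed.

HB.instance Definition _ :=
  GRing.isZmodClosed.Build free tensor_kernel tensor_kernel_zmod_closed.

Definition tensor : Type := Quotient.quot tensor_kernel.
HB.instance Definition _ := GRing.Zmodule.on tensor.

Let proj (f : free) : tensor := \pi_(Quotient.quot tensor_kernel) f.

Fact tensor_projP (f g : free) : proj f = proj g <-> f - g \in tensor_kernel.
Proof.
by rewrite Quotient.idealrBE; split=> [/eqP|/eqP].
Qed.

Fact tensor_projD (f g : free) : proj (f + g) = proj f + proj g.
Proof. exact: (Quotient.pi_add tensor_kernel f g). Qed.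

Let proj_repr (t : tensor) : proj (repr t) = t.
Proof. exact: reprK. Qed.

Definition tensor_scale (k : K) (t : tensor) : tensor := proj (k *: repr t).

Fact tensor_projZ k (f : free) : tensor_scale k (proj f) = proj (k *: f).
Proof.
apply/tensor_projP; have [k0 kD] := span_submod_closed tensor_relator.
rewrite -scalerBr -[_ *: _]addr0; apply: kD k0.
by apply/tensor_projP; rewrite proj_repr.
Qed.

Fact tensor_scaleA a b t :
  tensor_scale a (tensor_scale b t) = tensor_scale (a * b) t.
Proof. by rewrite -[t]proj_repr !tensor_projZ scalerA. Qed.

Fact tensor_scale1 : left_id 1 tensor_scale.
Proof. by move=> t; rewrite -[t]proj_repr tensor_projZ scale1r. Qed.

Fact tensor_scaleDr : right_distributive tensor_scale +%R.
Proof.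
move=> a t u; rewrite -[t]proj_repr -[u]proj_repr -tensor_projD.
by rewrite !tensor_projZ scalerDr tensor_projD.
Qed.

Fact tensor_scaleDl t : {morph tensor_scale^~ t : a b / a + b}.
Proof.
move=> a b; rewrite -[t]proj_repr.
by rewrite !tensor_projZ scalerDl tensor_projD.
Qed.

HB.instance Definition _ := GRing.Zmodule_isLmodule.Build K tensor
  tensor_scaleA tensor_scale1 tensor_scaleDr tensor_scaleDl.

Let projZ k (f : free) : k *: proj f = proj (k *: f).
Proof. exact: tensor_projZ. Qed.

Definition tens (u : U) (v : V) : tensor := proj (gen u v).

Lemma tens_bilinear : bilinear_for *:%R *:%R tens.
Proof.
split=> [v k u u'|u k v v']; rewrite /tens.
all: rewrite /= projZ -tensor_projD.
all: apply/tensor_projP; apply/asboolP.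
  exists [:: (1, gen (k *: u + u') v - (k *: gen u v + gen u' v))].
    by move=> p; rewrite inE => /eqP ->; constructor.
  by rewrite big_seq1 scale1r.
exists [:: (1, gen u (k *: v + v') - (k *: gen u v + gen u v'))].
  by move=> p; rewrite inE => /eqP ->; constructor.
by rewrite big_seq1 scale1r.
Qed.

Lemma tensor_ind (t : tensor) :
  exists s : seq (K * (U * V)), t = \sum_(p <- s) p.1 *: tens p.2.1 p.2.2.
Proof.
exists [seq (coeff z (repr t), z) | z <- dom (repr t)].
rewrite big_map /= -{1}[t]proj_repr -{1}[repr t]freeg_sumE.
have proj0 : proj 0 = 0.
  by apply: (addIr (proj 0)); rewrite -tensor_projD !add0r.
rewrite (big_morph proj tensor_projD proj0).
apply: eq_bigr => -[u v] _ /=; rewrite projZ.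
congr proj; apply/eqP/freeg_eqP => z.
by rewrite coeffZ !coeffU mul1r.
Qed.

Variables (W : lmodType K) (f : U -> V -> W).

Definition tensor_lift (t : tensor) : W :=
  fglift (fun p : U * V => f p.1 p.2) (repr t).

Hypothesis f_bilin : bilinear_for *:%R *:%R f.

Let F := fglift (fun p : U * V => f p.1 p.2) : free -> W.

Let FB : {morph F : a b / a - b}.
Proof. exact: lift_is_additive. Qed.
Let F0 : F 0 = 0. Proof. by rewrite -(subrr 0) FB subrr. Qed.
Let FN a : F (- a) = - F a. Proof. by rewrite -[- a]add0r FB F0 add0r. Qed.
Let FD : {morph F : a b / a + b}.
Proof. by move=> a b; rewrite -{1}[b]opprK FB FN opprK. Qed.
Let FZ k : {morph F : a / k *: a}.
Proof.
move=> a; rewrite /= -{2}[a]freeg_sumE {1}/GRing.scale /= /fgscale.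
rewrite !(big_morph F FD F0) scaler_sumr; apply: eq_bigr => z _.
by rewrite /F !liftU scalerA.
Qed.
Let Fgen u v : F (gen u v) = f u v.
Proof. by rewrite /F /gen liftU scale1r. Qed.

Let F_kernel a : a \in tensor_kernel -> F a = 0.
Proof.
move=> /asboolP[s Ss ->]; rewrite (big_morph F FD F0) big_seq big1 // => p.
move=> /Ss rp; rewrite FZ; case: rp => [k u u' v|k u v v'].
  by rewrite FB FD FZ !Fgen (f_bilin.1 v k u u') /= subrr scaler0.
by rewrite FB FD FZ !Fgen (f_bilin.2 u k v v') /= subrr scaler0.
Qed.

Let lift_proj a : tensor_lift (proj a) = F a.
Proof.
apply/eqP; rewrite -subr_eq0 -FB; apply/eqP/F_kernel/tensor_projP.
exact: proj_repr.
Qed.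

Lemma tensor_lift_linear : linear tensor_lift.
Proof.
move=> k t u; rewrite -[t]proj_repr -[u]proj_repr.
have -> a b : k *: proj a + proj b = proj (k *: a + b).
  by rewrite projZ tensor_projD.
by rewrite !lift_proj FD FZ.
Qed.

Lemma tensor_liftE u v : tensor_lift (tens u v) = f u v.
Proof. by rewrite lift_proj Fgen. Qed.

Lemma tensor_lift_uniq (g : tensor -> W) :
  linear g -> (forall u v, g (tens u v) = f u v) -> g =1 tensor_lift.
Proof.
move=> g_lin gE t; have [s ->] := tensor_ind t.
have lin0 (h : tensor -> W) : linear h -> h 0 = 0.
  move=> h_lin; have := h_lin 1 0 0; rewrite !scale1r addr0 => /eqP.
  by rewrite -subr_eq0 opprD addNKr oppr_eq0 => /eqP.
elim: s => [|p s IHs]; first by rewrite big_nil !lin0 //; apply: tensor_lift_linear.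
by rewrite big_cons g_lin tensor_lift_linear IHs gE tensor_liftE.
Qed.

End Tensor.

Section ColorAlgebras.
Variables (K : fieldType) (G : zmodType).

Record is_bicharacter (eps : G -> G -> K) : Prop := {
  bichar_neq0 : forall a b, eps a b != 0;
  bichar_skew : forall a b, eps a b * eps b a = 1;
  bicharDr : forall a b c, eps a (b + c) = eps a b * eps a c;
  bicharDl : forall a b c, eps (a + b) c = eps a c * eps b c
}.

(* [A] is the internal direct sum of the subspaces [V a], a in G. *)
Record is_grading (A : lmodType K) (V : G -> {pred A}) : Prop := {
  grading_submod : forall a, submod_closed (V a);
  grading_sum : forall x, exists (s : seq G) (f : G -> A),
    [/\ uniq s, (forall a, f a \in V a) & x = \sum_(a <- s) f a];
  grading_direct : forall (s : seq G) (f : G -> A),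
    uniq s -> (forall a, f a \in V a) ->
    \sum_(a <- s) f a = 0 -> forall a, a \in s -> f a = 0
}.

Definition tensor_grading (A B : lmodType K) (V : G -> {pred A})
    (W : G -> {pred B}) (c : G) : {pred tensor A B} :=
  span (fun t => exists a b x y,
    [/\ x \in V a, y \in W b, a + b = c & t = tens x y]).

Definition trilinear (A : lmodType K) (m : A -> A -> A -> A) : Prop :=
  [/\ forall y z, linear (fun x => m x y z),
      forall x z, linear (fun y => m x y z)
    & forall x y, linear (fun z => m x y z)].

Definition even2 (A : lmodType K) (V : G -> {pred A}) (m : A -> A -> A) : Prop :=
  forall a b x y, x \in V a -> y \in V b -> m x y \in V (a + b).

Definition even3 (A : lmodType K) (V : G -> {pred A})
    (m : A -> A -> A -> A) : Prop :=
  forall a b c x y z, x \in V a -> y \in V b -> z \in V c ->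
    m x y z \in V (a + b + c).

(* Identities on homogeneous elements quantify over the degrees together with *)
(* the elements: a nonzero homogeneous element has only one degree, and for   *)
(* zero, which lies in every [V a], the identities hold whatever the degree.  *)

Record is_ncLeibnizPoisson_color (P : lmodType K) (V : G -> {pred P})
    (mul br : P -> P -> P) (eps : G -> G -> K) : Prop := {
  nclp_grading : is_grading V;
  nclp_bichar : is_bicharacter eps;
  nclp_mul_bilinear : bilinear_for *:%R *:%R mul;
  nclp_mul_even : even2 V mul;
  nclp_br_bilinear : bilinear_for *:%R *:%R br;
  nclp_br_even : even2 V br;
  nclp_mulA : forall a b c x y z, x \in V a -> y \in V b -> z \in V c ->
    mul (mul x y) z = mul x (mul y z);
  nclp_leibniz : forall a b c x y z, x \in V a -> y \in V b -> z \in V c ->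
    br (br x y) z = br x (br y z) + eps b c *: br (br x z) y;
  nclp_deriv : forall a b c x y z, x \in V a -> y \in V b -> z \in V c ->
    br (mul x y) z = mul x (br y z) + eps b c *: mul (br x z) y
}.

Record is_ncTernaryLNP_color (A : lmodType K) (V : G -> {pred A})
    (mul : A -> A -> A) (br : A -> A -> A -> A) (eps : G -> G -> K) : Prop := {
  nctlnp_grading : is_grading V;
  nctlnp_bichar : is_bicharacter eps;
  nctlnp_mul_bilinear : bilinear_for *:%R *:%R mul;
  nctlnp_mul_even : even2 V mul;
  nctlnp_br_trilinear : trilinear br;
  nctlnp_br_even : even3 V br;
  nctlnp_mulA : forall a b c x y z, x \in V a -> y \in V b -> z \in V c ->
    mul (mul x y) z = mul x (mul y z);
  nctlnp_leibniz : forall a b c d e x y z t u,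
    x \in V a -> y \in V b -> z \in V c -> t \in V d -> u \in V e ->
    br (br x y z) t u = br x y (br z t u)
      + eps c (d + e) *: br x (br y t u) z
      + eps (b + c) (d + e) *: br (br x t u) y z;
  nctlnp_deriv : forall a b c d x y z t,
    x \in V a -> y \in V b -> z \in V c -> t \in V d ->
    br (mul x y) z t = mul x (br y z t) + eps b (c + d) *: mul (br x z t) y
}.

End ColorAlgebras.

(* Main.v *)
Require Import Defs.
From mathcomp Require Import all_boot all_algebra.
From mathcomp Require Import boolp.

(** The bracket of A (x) A is an action from the right. Write y.D for the value
at y of an operator D of degree d acting on the right; moving D past y costs
eps(y, d). An element x' (x) y' of A (x) A acts on A by y |-> [y, x', y'], which
extends linearly to an operator D_Y on A for every Y in A (x) A
([right_action]), and any operator D of degree d on A extends to A (x) A by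

   (x (x) y).D = x (x) y.D + eps(y, d) x.D (x) y     ([color_extension]).

The required bracket is [X, Y] = X.D_Y. In these terms the axioms separate into
facts about single operators.

- The ternary Leibniz identity says that
  x.D_Y.D_Z = x.D_[Y, Z] + eps(Y, Z) x.D_Z.D_Y on A
  ([right_action_commutator]): its two middle terms combine exactly into the
  bracket of Y = y (x) z with Z. A relation of this shape passes from operators
  on A to their extensions ([color_extension_commutator]): the two cross terms
  are exchanged by the swap of the operators and match because
  eps(c, d) eps(d, c) = 1. The result is the Leibniz identity of A (x) A.

- The ternary derivation rule says that each D_Z is a color derivation of A
  ([right_action_derivation]), and the extension of a color derivation is one of
  the color product of A (x) A ([color_extension_derivation]).

The signs eps make sense for homogeneous elements only, so that product and
bracket have to be defined from formulas that depend on the degree. Given one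
linear map for each degree, [glue] is the linear map that agrees with the a-th
one on the a-th component; directness of the grading makes it well defined
([homogeneous_relation]). Gluing also yields the projections of A (x) A onto its
components, hence that A (x) A is graded ([tensor_grading_is_grading]), after
which the degree of Y in [X, Y] can be glued over in turn. *)

Set Implicit Arguments.
Unset Strict Implicit.
Unset Printing Implicit Defensive.

Import GRing.Theory.
Local Open Scope ring_scope.

(** * Linear maps and spans *)

Section LinearMaps.
Variables (K : fieldType) (U V W : lmodType K).
Implicit Types f g : U -> W.

Lemma linear_fun0 f : linear f -> f 0 = 0.
Proof.
move=> lf; have := lf (-1) 0 0.
by rewrite scaler0 addr0 scaleN1r addNr.
Qed.

Lemma linear_funD f : linear f -> {morph f : x y / x + y}.
Proof. by move=> lf x y; have := lf 1 x y; rewrite !scale1r. Qed.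

Lemma linear_funZ f k : linear f -> {morph f : x / k *: x}.
Proof.
by move=> lf x; have := lf k x 0; rewrite !addr0 linear_fun0 // addr0.
Qed.

Lemma linear_fun_sum f (I : Type) (s : seq I) (P : pred I) (F : I -> U) :
  linear f -> f (\sum_(i <- s | P i) F i) = \sum_(i <- s | P i) f (F i).
Proof.
by move=> lf; apply: (big_morph f); [apply: linear_funD | apply: linear_fun0].
Qed.

Lemma linear_add f g : linear f -> linear g -> linear (fun x => f x + g x).
Proof. by move=> lf lg k x y; rewrite lf lg scalerDr addrACA. Qed.

Lemma linear_scale f c : linear f -> linear (fun x => c *: f x).
Proof. by move=> lf k x y; rewrite lf scalerDr !scalerA mulrC. Qed.

Lemma linear_comp (g : U -> V) (h : V -> W) :
  linear g -> linear h -> linear (fun x => h (g x)).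
Proof. by move=> lg lh k x y; rewrite lg lh. Qed.

Lemma linear_sum (I : Type) (s : seq I) (F : I -> U -> W) :
  (forall i, linear (F i)) -> linear (fun x => \sum_(i <- s) F i x).
Proof.
move=> lF k x y; rewrite scaler_sumr -big_split.
by apply: eq_bigr => i _; rewrite lF.
Qed.

End LinearMaps.

Section Span.
Variables (K : fieldType) (V : lmodType K) (S : V -> Prop).

Lemma span_ind (P : V -> Prop) :
  P 0 -> (forall k u v, P u -> P v -> P (k *: u + v)) ->
  (forall v, S v -> P v) -> forall v, v \in Defs.span S -> P v.
Proof.
move=> P0 PD PS v /asboolP[s Ss ->].
elim: s Ss => [|p s IHs] Ss; first by rewrite big_nil.
rewrite big_cons; apply: PD; first by apply/PS/Ss; rewrite mem_head.
by apply: IHs => q qs; apply: Ss; rewrite inE qs orbT.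
Qed.

Lemma mem_span v : S v -> v \in Defs.span S.
Proof.
move=> Sv; apply/asboolP; exists [:: (1, v)]; last by rewrite big_seq1 scale1r.
by move=> p; rewrite inE => /eqP->.
Qed.

Lemma span_ext (W : lmodType K) (f g : V -> W) :
  linear f -> linear g -> (forall v, S v -> f v = g v) ->
  forall v, v \in Defs.span S -> f v = g v.
Proof.
move=> lf lg; apply: (span_ind (P := fun v => f v = g v)).
  by rewrite !linear_fun0.
by move=> k u v fu fv; rewrite lf lg fu fv.
Qed.

Lemma span_img (W : lmodType K) (T : {pred W}) (f : V -> W) :
  linear f -> submod_closed T -> (forall v, S v -> f v \in T) ->
  forall v, v \in Defs.span S -> f v \in T.
Proof.
move=> lf [T0 TD]; apply: (span_ind (P := fun v => f v \in T)).
  by rewrite linear_fun0.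
by move=> k u v fu fv; rewrite lf; apply: TD.
Qed.

End Span.

Lemma submod_closed_scale (K : fieldType) (V : lmodType K) (T : {pred V}) k v :
  submod_closed T -> v \in T -> k *: v \in T.
Proof. by move=> [T0 TD] Tv; rewrite -[_ *: _]addr0 TD. Qed.

Lemma submod_closed_sum (K : fieldType) (V : lmodType K) (T : {pred V})
    (I : eqType) (s : seq I) (P : pred I) (F : I -> V) :
  submod_closed T -> (forall i, i \in s -> P i -> F i \in T) ->
  \sum_(i <- s | P i) F i \in T.
Proof.
move=> [T0 TD] FT; rewrite big_seq_cond.
apply: (big_ind (fun x => x \in T)) => //.
  by move=> x y Tx Ty; rewrite -[x]scale1r; apply: TD.
by move=> i /andP[]; apply: FT.
Qed.

Lemma sum_fibers (I J : eqType) (W : nmodType) (h : I -> J) (l : seq I)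
    (F : I -> W) :
  \sum_(i <- l) F i =
  \sum_(a <- undup (map h l)) \sum_(i <- l | h i == a) F i.
Proof.
rewrite (exchange_big_dep predT) //= big_seq [RHS]big_seq.
apply: eq_bigr => i il; rewrite big_mkcond (bigD1_seq (h i)) ?undup_uniq //=.
  by rewrite eqxx big1 ?addr0 // => a; rewrite eq_sym => /negPf->.
by rewrite mem_undup map_f.
Qed.

(** * Linear maps defined degree by degree *)

Section Gradings.
Variables (K : fieldType) (G : zmodType).

Definition homogeneous (A : lmodType K) (V : G -> {pred A}) (x : A) : Prop :=
  exists a, x \in V a.

(** A decomposition into homogeneous terms in which degrees may repeat, so that
such families can be concatenated. *)
Definition homogeneous_family (A : lmodType K) (V : G -> {pred A})
    (l : seq (G * A)) : Prop :=
  forall p, p \in l -> p.2 \in V p.1.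

Section Glue.
Variables (A W : lmodType K) (V : G -> {pred A}).

(** One decomposition is chosen for each x; [glue_parts] shows that the value of
[glue] at a family of linear maps does not depend on it. *)
Definition homogeneous_parts (x : A) : seq (G * A) :=
  if pselect (exists l, homogeneous_family V l /\ x = \sum_(p <- l) p.2)
  is left e then sval (cid e) else [::].

Definition glue (f : G -> A -> W) (x : A) : W :=
  \sum_(p <- homogeneous_parts x) f p.1 p.2.

(** The chosen decomposition depends on x alone, so that gluing is linear in any
further parameter. This is what keeps iterated gluings multilinear. *)
Lemma glue_linear_param (T : lmodType K) (f : T -> G -> A -> W) x :
  (forall a y, linear (fun t => f t a y)) -> linear (fun t => glue (f t) x).
Proof. by move=> lf; apply: linear_sum => p; apply: lf. Qed.

Hypothesis gV : is_grading V.

Lemma homogeneous_partsP x :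
  homogeneous_family V (homogeneous_parts x)
  /\ x = \sum_(p <- homogeneous_parts x) p.2.
Proof.
rewrite /homogeneous_parts; case: pselect => [e|[]]; first by case: (cid e).
have [s [f [_ fV ->]]] := grading_sum gV x.
exists [seq (a, f a) | a <- s]; split; last by rewrite big_map.
by move=> p /mapP[a _ ->]; apply: fV.
Qed.

(** Grouping the terms of equal degree turns the relation into one between
distinct degrees, where directness makes every group vanish before f is
applied. *)
Lemma homogeneous_relation (f : G -> A -> W) (l : seq (G * A)) :
  (forall a, linear (f a)) -> homogeneous_family V l ->
  \sum_(p <- l) p.2 = 0 -> \sum_(p <- l) f p.1 p.2 = 0.
Proof.
move=> lf lV.
pose h a := \sum_(p <- l | p.1 == a) p.2.
have hV a : h a \in V a.
  apply: submod_closed_sum; first exact: grading_submod gV a.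
  by move=> p /lV pV /eqP<-.
rewrite (sum_fibers fst l snd) (sum_fibers fst l (fun p => f p.1 p.2)) => l0.
rewrite big_seq big1 // => a al.
transitivity (f a (h a)); last first.
  by rewrite (grading_direct gV (undup_uniq _) hV l0 al) linear_fun0.
by rewrite linear_fun_sum //; apply: eq_bigr => p /eqP->.
Qed.

Lemma glue_parts (f : G -> A -> W) (l : seq (G * A)) :
  (forall a, linear (f a)) -> homogeneous_family V l ->
  glue f (\sum_(p <- l) p.2) = \sum_(p <- l) f p.1 p.2.
Proof.
move=> lf lV; set x := \sum_(p <- l) p.2.
have [xV xE] := homogeneous_partsP x.
pose l' := [seq (p.1, - p.2) | p <- l].
have l'V : homogeneous_family V l'.
  move=> _ /mapP[p pl ->] /=; rewrite -scaleN1r.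
  by apply: submod_closed_scale (grading_submod gV p.1) _; apply: lV.
have /homogeneous_relation : homogeneous_family V (homogeneous_parts x ++ l').
  by move=> p; rewrite mem_cat => /orP[/xV|/l'V].
(* the terms of two decompositions of x, one negated, form a relation *)
rewrite !big_cat -xE !big_map /= sumrN subrr => /(_ f lf erefl)/eqP.
rewrite big_cat big_map /=.
have -> : \sum_(p <- l) f p.1 (- p.2) = - \sum_(p <- l) f p.1 p.2.
  rewrite -sumrN; apply: eq_bigr => p _.
  by rewrite -scaleN1r linear_funZ // scaleN1r.
by rewrite subr_eq0 => /eqP.
Qed.

Lemma glueE (f : G -> A -> W) a x :
  (forall a, linear (f a)) -> x \in V a -> glue f x = f a x.
Proof.
move=> lf xV; have := @glue_parts f [:: (a, x)] lf; rewrite !big_seq1; apply.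
by move=> p; rewrite inE => /eqP->.
Qed.

Lemma glue_linear (f : G -> A -> W) :
  (forall a, linear (f a)) -> linear (glue f).
Proof.
move=> lf k x y.
have [xV xE] := homogeneous_partsP x; have [yV yE] := homogeneous_partsP y.
pose l := [seq (p.1, k *: p.2) | p <- homogeneous_parts x]
  ++ homogeneous_parts y.
have -> : k *: x + y = \sum_(p <- l) p.2.
  by rewrite big_cat big_map -scaler_sumr /= -xE -yE.
rewrite glue_parts //.
  rewrite big_cat big_map scaler_sumr; congr (_ + _).
  by apply: eq_bigr => p _; rewrite linear_funZ.
move=> p; rewrite mem_cat => /orP[/mapP[q /xV qV ->]|/yV //] /=.
exact: submod_closed_scale (grading_submod gV q.1) qV.
Qed.

End Glue.

Lemma span_homogeneous (A : lmodType K) (V : G -> {pred A}) x :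
  is_grading V -> x \in Defs.span (homogeneous V).
Proof.
move=> gV; have [xV ->] := homogeneous_partsP gV x.
apply: submod_closed_sum; first exact: span_submod_closed.
by move=> p /xV pV _; apply: mem_span; exists p.1.
Qed.

Lemma homogeneous_ext (A W : lmodType K) (V : G -> {pred A}) (f g : A -> W) :
  is_grading V -> linear f -> linear g ->
  (forall a x, x \in V a -> f x = g x) -> f =1 g.
Proof.
move=> gV lf lg fg x; apply: span_ext (span_homogeneous x gV) => // v [a].
exact: fg.
Qed.

(** Directness comes for free from projections: the a-th one, applied to a
vanishing sum of homogeneous terms, isolates the term of degree a. *)
Lemma grading_of_projections (A : lmodType K) (V : G -> {pred A})
    (pi : G -> A -> A) :
  (forall a, submod_closed (V a)) ->
  (forall x, x \in Defs.span (homogeneous V)) ->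
  (forall a, linear (pi a)) ->
  (forall a b x, x \in V b -> pi a x = if b == a then x else 0) ->
  is_grading V.
Proof.
move=> Vsub Vspan lpi piE; split=> // [x|s f us fV f0 a a_s].
  have [l [lV ->]] : exists l, homogeneous_family V l /\ x = \sum_(p <- l) p.2.
    move: x (Vspan x).
    apply: span_ind => [|k u v [l [lV ->]] [m [mV ->]]|v [a av]].
    - by exists [::]; split=> //; rewrite big_nil.
    - exists ([seq (p.1, k *: p.2) | p <- l] ++ m); split.
        move=> p; rewrite mem_cat => /orP[/mapP[q /lV qV ->]|/mV //] /=.
        exact: submod_closed_scale (Vsub q.1) qV.
      by rewrite big_cat big_map -scaler_sumr.
    - exists [:: (a, v)]; split; last by rewrite big_seq1.
      by move=> p; rewrite inE => /eqP->.
  exists (undup (map fst l)), (fun a => \sum_(p <- l | p.1 == a) p.2).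
  split; [exact: undup_uniq | | exact: sum_fibers].
  by move=> a; apply: submod_closed_sum => // p /lV pV /eqP<-.
have := congr1 (pi a) f0; rewrite linear_fun_sum // linear_fun0 // => <-.
rewrite (bigD1_seq a) //= (piE _ a) ?fV // eqxx big1 ?addr0 // => b ba.
by rewrite (piE _ b) ?fV // (negPf ba).
Qed.

Definition component (A : lmodType K) (V : G -> {pred A}) (a : G) : A -> A :=
  glue V (fun b x => if b == a then x else 0).

Lemma component_summand_linear (A : lmodType K) (a b : G) :
  linear (fun x : A => if b == a then x else 0).
Proof. by case: eqP => // _ k x y; rewrite scaler0 addr0. Qed.

Lemma component_linear (A : lmodType K) (V : G -> {pred A}) a :
  is_grading V -> linear (component V a).
Proof.
by move=> gV; apply: glue_linear => // b; apply: component_summand_linear.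
Qed.

Lemma componentE (A : lmodType K) (V : G -> {pred A}) a b x :
  is_grading V -> x \in V b -> component V a x = if b == a then x else 0.
Proof.
move=> gV xV; rewrite /component (glueE gV _ xV) // => c.
exact: component_summand_linear.
Qed.

End Gradings.

(** * The grading of a tensor product *)

Section Tensors.
Variables (K : fieldType) (A B W : lmodType K).

Lemma tens_linearl (y : B) : linear (fun x : A => tens x y).
Proof. exact: (tens_bilinear A B).1. Qed.

Lemma tens_linearr (x : A) : linear (fun y : B => tens x y).
Proof. exact: (tens_bilinear A B).2. Qed.

Lemma span_tens (t : tensor A B) :
  t \in Defs.span (fun t => exists x y, t = tens x y).
Proof.
have [s ->] := tensor_ind t; apply: submod_closed_sum => [|p _ _].
  exact: span_submod_closed.
apply: submod_closed_scale; first exact: span_submod_closed.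
by apply: mem_span; exists p.2.1, p.2.2.
Qed.

Lemma tensor_ext (f g : tensor A B -> W) :
  linear f -> linear g -> (forall x y, f (tens x y) = g (tens x y)) -> f =1 g.
Proof.
move=> lf lg fg t; apply: span_ext (span_tens t) => // _ [x [y ->]].
exact: fg.
Qed.

Lemma tensor_lift_linear_param (T : lmodType K) (f : T -> A -> B -> W) t :
  (forall s, bilinear_for *:%R *:%R (f s)) ->
  (forall x y, linear (fun s => f s x y)) ->
  linear (fun s => tensor_lift (f s) t).
Proof.
move=> bf lf k s s'; move: t; apply: tensor_ext.
- exact: tensor_lift_linear.
- by apply: linear_add; [apply: linear_scale|]; apply: tensor_lift_linear.
- by move=> x y; rewrite !tensor_liftE // lf.
Qed.

End Tensors.

Section TensorGrading.
Variables (K : fieldType) (G : zmodType) (A B : lmodType K).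
Variables (V : G -> {pred A}) (W : G -> {pred B}).

Lemma mem_tens a b x y :
  x \in V a -> y \in W b -> tens x y \in tensor_grading V W (a + b).
Proof. by move=> xV yW; apply: mem_span; exists a, b, x, y. Qed.

Lemma tensor_grading_submod c : submod_closed (tensor_grading V W c).
Proof. exact: span_submod_closed. Qed.

Lemma tensor_grading_ext (C : lmodType K) (f g : tensor A B -> C) c :
  linear f -> linear g ->
  (forall a b x y, x \in V a -> y \in W b -> a + b = c ->
     f (tens x y) = g (tens x y)) ->
  forall t, t \in tensor_grading V W c -> f t = g t.
Proof.
move=> lf lg fg; apply: span_ext => // _ [a [b [x [y [xV yW abc ->]]]]].
exact: fg xV yW abc.
Qed.

Lemma tensor_grading_img (C : lmodType K) (T : {pred C})
    (f : tensor A B -> C) c :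
  linear f -> submod_closed T ->
  (forall a b x y, x \in V a -> y \in W b -> a + b = c -> f (tens x y) \in T) ->
  forall t, t \in tensor_grading V W c -> f t \in T.
Proof.
move=> lf ST fT; apply: span_img => // _ [a [b [x [y [xV yW abc ->]]]]].
exact: fT xV yW abc.
Qed.

Hypotheses (gV : is_grading V) (gW : is_grading W).

Lemma tensor_homogeneous_ext (C : lmodType K) (f g : tensor A B -> C) :
  linear f -> linear g ->
  (forall a b x y, x \in V a -> y \in W b -> f (tens x y) = g (tens x y)) ->
  f =1 g.
Proof.
move=> lf lg fg; apply: tensor_ext => // x y; move: x.
apply: (homogeneous_ext gV) => [||a x xV].
- exact: linear_comp (tens_linearl y) lf.
- exact: linear_comp (tens_linearl y) lg.
move: y; apply: (homogeneous_ext gW) => [||b y yW].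
- exact: linear_comp (tens_linearr x) lf.
- exact: linear_comp (tens_linearr x) lg.
exact: fg xV yW.
Qed.

Definition tensor_component (c : G) : tensor A B -> tensor A B :=
  tensor_lift
    (fun x y => glue V (fun a x => tens x (component W (c - a) y)) x).

Lemma tensor_component_bilinear c :
  bilinear_for *:%R *:%R
    (fun x y => glue V (fun a x => tens x (component W (c - a) y)) x).
Proof.
split=> [y|x]; first by apply: glue_linear => // a; apply: tens_linearl.
apply: glue_linear_param => a x'.
exact: linear_comp (component_linear _ gW) (tens_linearr _).
Qed.

Lemma tensor_component_linear c : linear (tensor_component c).
Proof. exact/tensor_lift_linear/tensor_component_bilinear. Qed.

Lemma tensor_component_tens a b c x y :
  x \in V a -> y \in W b ->
  tensor_component c (tens x y) = if a + b == c then tens x y else 0.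
Proof.
move=> xV yW; rewrite /tensor_component tensor_liftE; last first.
  exact: tensor_component_bilinear.
rewrite (glueE gV _ xV) => [|a']; last exact: tens_linearl.
have -> : (a + b == c) = (b == c - a).
  by rewrite [RHS]eq_sym subr_eq [b + a]addrC eq_sym.
rewrite (componentE _ gW yW); case: eqP => // _.
exact: linear_fun0 (tens_linearr x).
Qed.

Lemma tensor_grading_is_grading : is_grading (tensor_grading V W).
Proof.
apply: (grading_of_projections (pi := tensor_component)).
- exact: tensor_grading_submod.
- have Sspan := span_submod_closed (homogeneous (tensor_grading V W)).
  move=> t; apply: (span_img (f := id)) (span_tens t) => // _ [x [y ->]].
  apply: (span_img (tens_linearl y) Sspan) (span_homogeneous x gV).
  move=> {}x [a xV].
  apply: (span_img (tens_linearr x) Sspan) (span_homogeneous y gW).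
  move=> {}y [b yW].
  by apply: mem_span; exists (a + b); apply: mem_tens.
- exact: tensor_component_linear.
move=> c d; apply: tensor_grading_ext; first exact: tensor_component_linear.
  exact: component_summand_linear.
by move=> a b x y xV yW <-; apply: tensor_component_tens.
Qed.

End TensorGrading.

(** * Extension of a homogeneous operator to the tensor square *)

Section ColorTensor.
Variables (K : fieldType) (G : zmodType) (A : lmodType K).
Variables (V : G -> {pred A}) (eps : G -> G -> K).
Hypotheses (gV : is_grading V) (eps_bichar : is_bicharacter eps).

Lemma bichar_cancel a b x : eps a b * x * eps b a = x.
Proof. by rewrite mulrAC (bichar_skew eps_bichar) mul1r. Qed.

Section Extension.

Definition color_extension_tens (d : G) (T : A -> A) (x y : A) : tensor A A :=
  tens x (T y) + glue V (fun b y => eps b d *: tens (T x) y) y.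

(** For T acting from the right: T reaches y at once, and reaches x after moving
past y. The degree d of T is a separate argument because the zero operator has
every degree. *)
Definition color_extension (d : G) (T : A -> A) : tensor A A -> tensor A A :=
  tensor_lift (color_extension_tens d T).

Lemma color_extension_bilinear d T :
  linear T -> bilinear_for *:%R *:%R (color_extension_tens d T).
Proof.
move=> lT; split=> [y|x]; apply: linear_add.
- exact: tens_linearl.
- apply: glue_linear_param => b z; apply: linear_scale.
  exact: linear_comp lT (tens_linearl z).
- exact: linear_comp lT (tens_linearr x).
- by apply: glue_linear => // b; apply/linear_scale/tens_linearr.
Qed.

Lemma color_extension_linear d T : linear T -> linear (color_extension d T).
Proof. by move=> lT; apply/tensor_lift_linear/color_extension_bilinear. Qed.

Lemma color_extension_linear_param (S : lmodType K) d (T : S -> A -> A) X :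
  (forall s, linear (T s)) -> (forall x, linear (fun s => T s x)) ->
  linear (fun s => color_extension d (T s) X).
Proof.
move=> lT lTs; apply: tensor_lift_linear_param => [s|x y].
  exact: color_extension_bilinear.
apply: linear_add; first exact: linear_comp (lTs y) (tens_linearr x).
apply: glue_linear_param => b z; apply: linear_scale.
exact: linear_comp (lTs x) (tens_linearl z).
Qed.

Lemma color_extensionE d T b x y :
  linear T -> y \in V b ->
  color_extension d T (tens x y) = tens x (T y) + eps b d *: tens (T x) y.
Proof.
move=> lT yV; rewrite /color_extension tensor_liftE; last first.
  exact: color_extension_bilinear.
rewrite /color_extension_tens (glueE gV _ yV) // => c.
exact/linear_scale/tens_linearr.
Qed.

Definition has_degree (d : G) (T : A -> A) : Prop :=
  forall a x, x \in V a -> T x \in V (a + d).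

Lemma color_extension_even d T c X :
  linear T -> has_degree d T -> X \in tensor_grading V V c ->
  color_extension d T X \in tensor_grading V V (c + d).
Proof.
move=> lT dT; have [S0 SD] := tensor_grading_submod V V (c + d).
apply: tensor_grading_img => //; first exact: color_extension_linear.
move=> a b x y xV yV abc; rewrite (color_extensionE _ _ lT yV).
rewrite [tens _ _ + _]addrC SD // -abc.
  by rewrite addrAC mem_tens // dT.
by rewrite -addrA mem_tens // dT.
Qed.

(** In both orders of S and T the cross terms are Sx (x) Ty and Tx (x) Sy. The
factors of Tx (x) Sy, eps (b + c) d and eps c d * eps b d, agree by
multiplicativity; those of Sx (x) Ty, eps b c and eps c d * eps (b + d) c, agree
because eps c d * eps d c = 1. What is left is the relation on A in each tensor
factor. *)
Lemma color_extension_commutator c d S T U :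
  linear S -> linear T -> linear U -> has_degree c S -> has_degree d T ->
  (forall x, T (S x) = U x + eps c d *: S (T x)) ->
  forall X, color_extension d T (color_extension c S X)
    = color_extension (c + d) U X
      + eps c d *: color_extension c S (color_extension d T X).
Proof.
move=> lS lT lU dS dT TS.
have lS' := @color_extension_linear c S lS.
have lT' := @color_extension_linear d T lT.
apply: (tensor_homogeneous_ext gV gV) => [||a b x y xV yV].
- exact: linear_comp lS' lT'.
- apply: linear_add; first exact: color_extension_linear.
  exact/linear_scale/(linear_comp lT' lS').
have [dSy dTy] := (dS _ _ yV, dT _ _ yV).
rewrite !(color_extensionE _ _ _ yV) //.
rewrite (linear_funD lT') (linear_funZ _ lT') (linear_funD lS') (linear_funZ _ lS').
rewrite !(color_extensionE _ _ _ yV) //.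
rewrite !(color_extensionE _ _ _ dSy) // !(color_extensionE _ _ _ dTy) //.
rewrite !TS (linear_funD (tens_linearl y)) (linear_funD (tens_linearr x)).
rewrite (linear_funZ _ (tens_linearl y)) (linear_funZ _ (tens_linearr x)).
rewrite !scalerDr !scalerA !(bicharDl eps_bichar) !(bicharDr eps_bichar).
(* the cross terms come in the opposite order on the two sides *)
rewrite [LHS](AC (3*(1*2)) ((1*5)*((2*4)*(3*6)))).
congr (_ + (_ + _ *: _ + (_ *: _ + _ *: _))).
- by rewrite mulrA bichar_cancel.
- exact: mulrC.
- by rewrite mulrC mulrA mulrAC.
Qed.

End Extension.

(** * The color product *)

Section Product.
Variable mul : A -> A -> A.
Hypotheses (mul_bilinear : bilinear_for *:%R *:%R mul) (mul_even : even2 V mul).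

(** The sign depends on the degrees of the two middle factors y and x', hence
two nested gluings. *)
Definition color_mul_tens (x y x' y' : A) : tensor A A :=
  glue V (fun b y =>
    glue V (fun a x' => eps b a *: tens (mul x x') (mul y y')) x') y.

Lemma color_mul_tens_linear1 y x' y' : linear (fun x => color_mul_tens x y x' y').
Proof.
apply: glue_linear_param => b z; apply: glue_linear_param => a t.
by apply: linear_scale; apply: linear_comp (mul_bilinear.1 t) (tens_linearl _).
Qed.

Lemma color_mul_tens_linear2 x x' y' : linear (fun y => color_mul_tens x y x' y').
Proof.
apply: glue_linear => // b; apply: glue_linear_param => a t.
by apply: linear_scale; apply: linear_comp (mul_bilinear.1 y') (tens_linearr _).
Qed.

Lemma color_mul_tens_linear3 x y y' : linear (fun x' => color_mul_tens x y x' y').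
Proof.
apply: glue_linear_param => b z; apply: glue_linear => // a.
by apply: linear_scale; apply: linear_comp (mul_bilinear.2 x) (tens_linearl _).
Qed.

Lemma color_mul_tens_linear4 x y x' : linear (fun y' => color_mul_tens x y x' y').
Proof.
apply: glue_linear_param => b z; apply: glue_linear_param => a t.
by apply: linear_scale; apply: linear_comp (mul_bilinear.2 z) (tens_linearr _).
Qed.

Definition color_mul (X X' : tensor A A) : tensor A A :=
  tensor_lift (fun x y => tensor_lift (color_mul_tens x y) X') X.

Lemma color_mul_tens_bilinear x y : bilinear_for *:%R *:%R (color_mul_tens x y).
Proof.
by split=> z; [apply: color_mul_tens_linear3 | apply: color_mul_tens_linear4].
Qed.

Lemma color_mul_lift_bilinear X' :
  bilinear_for *:%R *:%R (fun x y => tensor_lift (color_mul_tens x y) X').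
Proof.
split=> z; apply: tensor_lift_linear_param => *; try exact: color_mul_tens_bilinear.
  exact: color_mul_tens_linear1.
exact: color_mul_tens_linear2.
Qed.

Lemma color_mul_linearl X' : linear (fun X => color_mul X X').
Proof. exact/tensor_lift_linear/color_mul_lift_bilinear. Qed.

Lemma color_mul_linearr X : linear (color_mul X).
Proof.
apply: tensor_lift_linear_param => [X'|x y]; first exact: color_mul_lift_bilinear.
exact/tensor_lift_linear/color_mul_tens_bilinear.
Qed.

Lemma color_mulE b a' x y x' y' :
  y \in V b -> x' \in V a' ->
  color_mul (tens x y) (tens x' y') = eps b a' *: tens (mul x x') (mul y y').
Proof.
move=> yV xV; rewrite /color_mul tensor_liftE; last exact: color_mul_lift_bilinear.
rewrite tensor_liftE; last exact: color_mul_tens_bilinear.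
rewrite /color_mul_tens (glueE gV _ yV) => [|c].
  rewrite (glueE gV _ xV) // => c.
  by apply: linear_scale; apply: linear_comp (mul_bilinear.2 x) (tens_linearl _).
apply: glue_linear_param => a t.
by apply: linear_scale; apply: linear_comp (mul_bilinear.1 y') (tens_linearr _).
Qed.

Lemma color_mul_even : even2 (tensor_grading V V) color_mul.
Proof.
move=> c c' X X' Xc X'c; move: X Xc.
apply: tensor_grading_img => [||a b x y xV yV abc].
- exact: color_mul_linearl.
- exact: tensor_grading_submod.
move: X' X'c; apply: tensor_grading_img => [||a' b' x' y' xV' yV' abc'].
- exact: color_mul_linearr.
- exact: tensor_grading_submod.
rewrite (color_mulE _ _ yV xV') -abc -abc' addrACA.
apply: submod_closed_scale; first exact: tensor_grading_submod.
by apply: mem_tens; apply: mul_even.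
Qed.

Lemma color_mulA :
  (forall a b c x y z, x \in V a -> y \in V b -> z \in V c ->
    mul (mul x y) z = mul x (mul y z)) ->
  associative color_mul.
Proof.
move=> mulA X Y Z; apply/esym; move: X.
apply: (tensor_homogeneous_ext gV gV) => [||a1 b1 x1 y1 x1V y1V].
- exact: linear_comp (color_mul_linearl Y) (color_mul_linearl Z).
- exact: color_mul_linearl.
move: Y; apply: (tensor_homogeneous_ext gV gV) => [||a2 b2 x2 y2 x2V y2V].
- exact: linear_comp (color_mul_linearr _) (color_mul_linearl Z).
- exact: linear_comp (color_mul_linearl Z) (color_mul_linearr _).
move: Z; apply: (tensor_homogeneous_ext gV gV) => [||a3 b3 x3 y3 x3V y3V].
- exact: color_mul_linearr.
- exact: linear_comp (color_mul_linearr _) (color_mul_linearr _).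
rewrite (color_mulE _ _ y1V x2V) (color_mulE _ _ y2V x3V).
rewrite (linear_funZ _ (color_mul_linearl _)) (linear_funZ _ (color_mul_linearr _)).
rewrite (color_mulE _ _ (mul_even y1V y2V) x3V).
rewrite (color_mulE _ _ y1V (mul_even x2V x3V)).
rewrite (mulA _ _ _ _ _ _ x1V x2V x3V) (mulA _ _ _ _ _ _ y1V y2V y3V) !scalerA.
rewrite (bicharDl eps_bichar) (bicharDr eps_bichar).
by congr (_ *: _); rewrite mulrA [RHS]mulrC.
Qed.

(** Both sides consist of the four terms in which T hits one of x, y, x', y'. The
only sign that needs more than multiplicativity of eps belongs to the term in
T y: in the last summand T moves past x' to reach X, and Ty then moves back past
x', which contributes eps a' d * eps d a' = 1. *)
Lemma color_extension_derivation d T :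
  linear T -> has_degree d T ->
  (forall a b x y, x \in V a -> y \in V b ->
     T (mul x y) = mul x (T y) + eps b d *: mul (T x) y) ->
  forall c X Y, Y \in tensor_grading V V c ->
    color_extension d T (color_mul X Y)
      = color_mul X (color_extension d T Y)
        + eps c d *: color_mul (color_extension d T X) Y.
Proof.
move=> lT dT Tmul c X Y Yc; have lT' := @color_extension_linear d T lT.
move: X; apply: (tensor_homogeneous_ext gV gV) => [||a b x y xV yV].
- exact: linear_comp (color_mul_linearl Y) lT'.
- apply: linear_add; first exact: color_mul_linearl.
  exact/linear_scale/(linear_comp lT' (color_mul_linearl Y)).
move: Y Yc; apply: tensor_grading_ext => [||a' b' x' y' xV' yV' <-].
- exact: linear_comp (color_mul_linearr _) lT'.
- apply: linear_add; first exact: linear_comp lT' (color_mul_linearr _).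
  exact/linear_scale/color_mul_linearr.
rewrite (color_mulE _ _ yV xV') (linear_funZ _ lT').
rewrite !(color_extensionE _ _ lT (mul_even yV yV')).
rewrite (color_extensionE _ _ lT yV) (color_extensionE _ _ lT yV').
rewrite (linear_funD (color_mul_linearr _)) (linear_funZ _ (color_mul_linearr _)).
rewrite (linear_funD (color_mul_linearl _)) (linear_funZ _ (color_mul_linearl _)).
rewrite !(color_mulE _ _ yV xV') (color_mulE _ _ (dT _ _ yV) xV').
rewrite (color_mulE _ _ yV (dT _ _ xV')).
rewrite (Tmul _ _ _ _ xV xV') (Tmul _ _ _ _ yV yV').
rewrite (linear_funD (tens_linearl _)) (linear_funD (tens_linearr _)).
rewrite (linear_funZ _ (tens_linearl _)) (linear_funZ _ (tens_linearr _)).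
rewrite !scalerDr !scalerA !(bicharDl eps_bichar) !(bicharDr eps_bichar).
rewrite [LHS](AC (2*2) ((1*3)*(2*4))).
congr (_ + _ *: _ + (_ *: _ + _ *: _)).
- by rewrite mulrA [LHS]mulrC.
- by rewrite [RHS]mulrA -[eps a' d * _ * _]mulrA bichar_cancel mulrC.
- by rewrite [LHS](AC (1*2*1) (4*3*2*1)).
Qed.

End Product.

(** * The bracket *)

Section Bracket.
Variable br : A -> A -> A -> A.
Hypotheses (br_trilinear : trilinear br) (br_even : even3 V br).

Lemma br_bilinear x : bilinear_for *:%R *:%R (br x).
Proof. by have [_ l2 l3] := br_trilinear; split=> z; [apply: l2 | apply: l3]. Qed.

Definition right_action (Y : tensor A A) (x : A) : A := tensor_lift (br x) Y.

Lemma right_actionE x y z : right_action (tens y z) x = br x y z.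
Proof. exact/tensor_liftE/br_bilinear. Qed.

Lemma right_action_linear Y : linear (right_action Y).
Proof.
have [l1 _ _] := br_trilinear.
by apply: tensor_lift_linear_param => [x|y z]; [apply: br_bilinear | apply: l1].
Qed.

Lemma right_action_linear_param x : linear (fun Y => right_action Y x).
Proof. exact/tensor_lift_linear/br_bilinear. Qed.

Lemma right_action_degree c Y :
  Y \in tensor_grading V V c -> has_degree c (right_action Y).
Proof.
move=> Yc a x xV; move: Y Yc; apply: tensor_grading_img => [||b b' y z yV zV <-].
- exact: right_action_linear_param.
- exact: grading_submod gV _.
by rewrite right_actionE addrA; apply: br_even.
Qed.

(** The operator of Y extends with a sign that involves the degree of Y, so the
gluing here is over the grading of the tensor square itself. *)
Definition color_bracket (X Y : tensor A A) : tensor A A :=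
  glue (tensor_grading V V) (fun c Y => color_extension c (right_action Y) X) Y.

Let gT : is_grading (tensor_grading V V) := tensor_grading_is_grading gV gV.

Lemma color_bracket_linearl Y : linear (fun X => color_bracket X Y).
Proof.
apply: glue_linear_param => c {}Y.
exact/color_extension_linear/right_action_linear.
Qed.

Lemma color_extension_action_linear c X :
  linear (fun Y => color_extension c (right_action Y) X).
Proof.
apply: color_extension_linear_param.
  exact: right_action_linear.
exact: right_action_linear_param.
Qed.

Lemma color_bracket_linearr X : linear (color_bracket X).
Proof. by apply: glue_linear => // c; apply: color_extension_action_linear. Qed.

Lemma color_bracketE c X Y : Y \in tensor_grading V V c ->
  color_bracket X Y = color_extension c (right_action Y) X.
Proof.
move=> Yc; rewrite /color_bracket (glueE gT _ Yc) // => d.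
exact: color_extension_action_linear.
Qed.

Lemma color_bracket_even : even2 (tensor_grading V V) color_bracket.
Proof.
move=> c d X Y Xc Yd; rewrite (color_bracketE _ Yd).
apply: color_extension_even Xc; first exact: right_action_linear.
exact: right_action_degree.
Qed.

(** For Y = y (x) z, expanding the operator of [Y, Z] gives
[x, y, z.D_Z] + eps(z, Z) [x, y.D_Z, z], which are the first two terms on the
right of the ternary Leibniz identity; the third one is x.D_Z.D_Y. *)
Lemma right_action_commutator :
  (forall a b c d e x y z t u,
    x \in V a -> y \in V b -> z \in V c -> t \in V d -> u \in V e ->
    br (br x y z) t u = br x y (br z t u)
      + eps c (d + e) *: br x (br y t u) z
      + eps (b + c) (d + e) *: br (br x t u) y z) ->
  forall c d Y Z, Y \in tensor_grading V V c -> Z \in tensor_grading V V d ->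
  forall x, right_action Z (right_action Y x) =
    right_action (color_bracket Y Z) x
    + eps c d *: right_action Y (right_action Z x).
Proof.
move=> leibniz c d Y Z Yc Zd; have lZ := right_action_linear Z.
have lP := right_action_linear_param.
apply: (homogeneous_ext gV) => [||a x xV].
- exact: linear_comp (right_action_linear Y) lZ.
- apply: linear_add; first exact: right_action_linear.
  exact/linear_scale/(linear_comp lZ (right_action_linear Y)).
move: Y Yc; apply: tensor_grading_ext => [||b b' y z yV zV <-].
- exact: linear_comp (lP x) lZ.
- apply: linear_add; first exact: linear_comp (color_bracket_linearl Z) (lP x).
  exact/linear_scale/lP.
rewrite (color_bracketE _ Zd) (color_extensionE _ _ lZ zV).
rewrite (linear_funD (lP x)) (linear_funZ _ (lP x)) !right_actionE {lZ}.
have [l1 l2 l3] := br_trilinear.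
move: Z Zd; apply: tensor_grading_ext => [||e e' t u tV uV <-].
- exact: lP.
- apply: linear_add; last exact/linear_scale/(linear_comp (lP x) (l1 y z)).
  apply: linear_add; first exact: linear_comp (lP z) (l3 x y).
  exact/linear_scale/(linear_comp (lP y) (l2 x z)).
rewrite !right_actionE; exact: leibniz xV yV zV tV uV.
Qed.

Lemma right_action_derivation (mul : A -> A -> A) :
  bilinear_for *:%R *:%R mul ->
  (forall a b c d x y z t,
    x \in V a -> y \in V b -> z \in V c -> t \in V d ->
    br (mul x y) z t = mul x (br y z t) + eps b (c + d) *: mul (br x z t) y) ->
  forall c Z, Z \in tensor_grading V V c ->
  forall a b x y, x \in V a -> y \in V b ->
    right_action Z (mul x y) =
    mul x (right_action Z y) + eps b c *: mul (right_action Z x) y.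
Proof.
move=> [mull mulr] deriv c Z Zc a b x y xV yV.
have lP := right_action_linear_param.
move: Z Zc; apply: tensor_grading_ext => [||d e z t zV tV <-].
- exact: lP.
- apply: linear_add; first exact: linear_comp (lP y) (mulr x).
  exact/linear_scale/(linear_comp (lP x) (mull y)).
rewrite !right_actionE; exact: deriv xV yV zV tV.
Qed.

End Bracket.
End ColorTensor.

Theorem theorem4p4 (K : fieldType) (charK : 2%N \notin [pchar K])
    (G : zmodType) (A : lmodType K) (V : G -> {pred A})
    (mul : A -> A -> A) (br : A -> A -> A -> A) (eps : G -> G -> K)
    (hA : is_ncTernaryLNP_color V mul br eps) :
  exists tmul tbr : tensor A A -> tensor A A -> tensor A A,
    [/\ forall a b a' b' x y x' y',
          x \in V a -> y \in V b -> x' \in V a' -> y' \in V b' ->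
          tmul (tens x y) (tens x' y')
            = eps b a' *: tens (mul x x') (mul y y'),
        forall a b a' b' x y x' y',
          x \in V a -> y \in V b -> x' \in V a' -> y' \in V b' ->
          tbr (tens x y) (tens x' y')
            = tens x (br y x' y') + eps b (a' + b') *: tens (br x x' y') y
      & is_ncLeibnizPoisson_color (tensor_grading V V) tmul tbr eps].
Proof.
case: hA => gV epsB mulL mulE brL brE mulA leibniz deriv.
have actL := right_action_linear brL.
have gT := tensor_grading_is_grading gV gV.
exists (color_mul V eps mul), (color_bracket V eps br); split.
- by move=> a b a' b' x y x' y' _ yV xV' _; apply: color_mulE.
- move=> a b a' b' x y x' y' xV yV xV' yV'.
  rewrite (color_bracketE eps gV brL _ (mem_tens xV' yV')).
  by rewrite (color_extensionE eps gV _ _ (actL _) yV) !right_actionE.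
split=> //.
- by split=> X; [apply: color_mul_linearl | apply: color_mul_linearr].
- exact: color_mul_even.
- by split=> X; [apply: color_bracket_linearl | apply: color_bracket_linearr].
- exact: color_bracket_even.
- by move=> *; rewrite color_mulA.
- move=> a b c X Y Z Xa Yb Zc.
  have act_YZ := right_action_commutator gV brL leibniz Yb Zc.
  have := color_bracket_even eps gV brL brE Yb Zc.
  set YZ := color_bracket V eps br Y Z in act_YZ * => YZbc.
  rewrite !(color_bracketE eps gV brL _ Zc) !(color_bracketE eps gV brL _ Yb).
  rewrite (color_bracketE eps gV brL _ YZbc).
  by apply: color_extension_commutator => //; apply: right_action_degree.
- move=> a b c X Y Z Xa Yb Zc; rewrite !(color_bracketE eps gV brL _ Zc).
  apply: (color_extension_derivation gV epsB mulL mulE) Yb => //.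
    exact: right_action_degree.
  exact: (right_action_derivation brL mulL deriv Zc).
Qed.
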